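(* Let $(G,F)$ be a framed graph and let $\mathrm{h}$ be an admissible height function for the framed triangulation $\Delta_{G,F}$. Then the tropical framingtope $\mathscr{P}_{G,F}^{\mathrm{h}}$ realizes the combinatorial framingtope $\mathscr{P}_{G,F}$: the polytopal complex $\mathscr{P}_{G,F}^{\mathrm{h}}$ of bounded cells of the tropical cell decomposition $\mathscr{T}^{\mathrm{h}}$, ordered by inclusion, is isomorphic as a poset to $\mathscr{P}_{G,F}$, the poset of interior faces of $\Delta_{G,F}$ ordered by reverse inclusion.
   Context: Flow graphs and flow polytopes. A flow graph $G$ is a finite directed acyclic graph (multiple edges allowed) with vertex set $[n]=\{1,\dots,n\}$ and edge multiset $E(G)$, all edges directed from smaller to larger vertices, with unique source $1$ and unique sink $n$. For a vertex $v$, $\mathrm{In}(v)$ and $\mathrm{Out}(v)$ are its sets of incoming and outgoing edges. A route is a directed path from $1$ to $n$; $R(G)$ is the set of routes. The flow polytope $\mathcal{F}_G\subset\mathbb{R}^{E(G)}$ is the set of nonnegative $(x_e)_{e}$ with $\sum_{e\in \mathrm{Out}(j)}x_e-\sum_{e\in \mathrm{In}(j)}x_e=u_j$ for all $j$, where $u_1=1$, $u_n=-1$, $u_j=0$ otherwise. Its vertices are the $0/1$ indicator vectors of the routes. Framings and coherence. A framing $F$ of $G$ is a choice, at every vertex $v$, of linear orders on $\mathrm{In}(v)$ and on $\mathrm{Out}(v)$; $(G,F)$ is called a framed graph. For a path $P$ through $v$ let $Pv$ (resp. $vP$) be its maximal subpath ending (resp. beginning) at $v$. For paths $P,Q$ through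 $v$: let $w\le v$ be the smallest vertex after which $Pv$ and $Qv$ coincide; if $w$ is the first vertex of $Pv$ or $Qv$, then $Pv=_{\mathscr{I}(v)}Qv$; otherwise $Pv<_{\mathscr{I}(v)}Qv$ iff the edge of $P$ entering $w$ is smaller, in the order on $\mathrm{In}(w)$, than the edge of $Q$ entering $w$. Similarly, let $w'\ge v$ be the largest vertex before which $vP$ and $vQ$ coincide; if $w'$ is the last vertex of $vP$ or $vQ$, then $vP=_{\mathscr{O}(v)}vQ$; otherwise $vP<_{\mathscr{O}(v)}vQ$ iff the edge of $P$ leaving $w'$ is smaller, in the order on $\mathrm{Out}(w')$, than the edge of $Q$ leaving $w'$. Two routes $P,Q$ are incoherent at a common inner vertex $v$ ($v\ne 1,n$) if $Pv<_{\mathscr{I}(v)}Qv$ and $vQ<_{\mathscr{O}(v)}vP$, or $Qv<_{\mathscr{I}(v)}Pv$ and $vP<_{\mathscr{O}(v)}vQ$; they are coherent otherwise, i.e. if they are incoherent at no common inner vertex. A clique is a set of pairwise coherent routes; a maximal clique is an inclusion-maximal one. Framed triangulation. For a clique $S$ let $\Delta_S$ be the convex hull of the indicator vectors of its routes. By Danilov–Karzanov–Koshevoy, the $\Delta_C$, $C$ a maximal clique, are the top-dimensional simplices of a regular unimodular triangulation $\Delta_{G,F}$ of $\mathcal{F}_G$ (the framed triangulation); its faces are the $\Delta_S$, $S$ a clique. A face is an interior face if it is not contained in the (relative) boundary of $\mathcal{F}_G$. Admissible height functions. A height function $\mathrm{h}:R(G)\to\mathbb{R}$ induces a regular subdivision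 of $\mathcal{F}_G$: lift the indicator vector of each $R$ to height $\mathrm{h}(R)$ and project the upper faces of the convex hull; equivalently, its faces are the convex hulls of the sets of routes minimizing $R\mapsto -\mathrm{h}(R)+\langle R,\mathbf{y}\rangle$ for $\mathbf{y}\in\mathbb{R}^{E(G)}$. $\mathrm{h}$ is admissible if this subdivision equals $\Delta_{G,F}$. Tropical arrangement. For $0\le i\le n-2$ label the outgoing edges of vertex $i+1$ by $e_{i,0},e_{i,1},\dots,e_{i,j_i}$ from bottom to top (drawing the framing as increasing from top to bottom, so in decreasing framing order). For each source edge $e_{0,i}$, $0\le i\le j_0$, let $\hat G_i$ be the smallest subgraph containing every route starting with $e_{0,i}$, and $G_i$ the graph obtained from $\hat G_i$ by deleting $e_{0,i}$ (its routes start at the head of $e_{0,i}$ and end at $n$). Let $I=\{(i,j):1\le i\le n-2,\ 1\le j\le j_i\}$; for a route $R$ let $\vec R\in\{0,1\}^I$ have $(i,j)$-coordinate $1$ iff $R$ uses $e_{i,j}$. For $\mathbf{x}\in\mathbb{R}^I$ put $$T_i^{\mathrm h}(\mathbf{x})=\min\{-\mathrm{h}(e_{0,i}R)+\langle \vec R,\mathbf{x}\rangle: R\in R(G_i)\},$$ where $e_{0,i}R$ is the route of $G$ obtained by prepending $e_{0,i}$ to $R$. $T_i^{\mathrm h}$ induces a polyhedral decomposition of $\mathbb{R}^I$ whose cells are the nonempty sets $\{\mathbf{x}: \text{every } R\in A \text{ attains the minimum}\}$, for nonempty $A\subseteq R(G_i)$. The tropical cell decomposition $\mathscr{T}^{\mathrm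 h}$ is the common refinement of these decompositions for $i=0,\dots,j_0$; its cells are the nonempty intersections of cells, one from each decomposition. The tropical framingtope $\mathscr{P}^{\mathrm h}_{G,F}$ is the polytopal complex of bounded cells of $\mathscr{T}^{\mathrm h}$. *)

(* Defs.v *)
From HB Require Import structures.
From mathcomp Require Import all_boot all_order all_algebra.
From mathcomp Require Import boolp classical_sets reals topology normedtype.

Set Implicit Arguments.
Unset Strict Implicit.
Unset Printing Implicit Defensive.

Import Order.TTheory GRing.Theory Num.Theory.
Import numFieldNormedType.Exports.

Local Open Scope classical_set_scope.
Local Open Scope ring_scope.

(* Convex geometry in R^T, for a finite index type T. Points are functions
   T -> R; the topology is that of {ptws T -> R}, i.e. the Euclidean one. *)

Section Convex.
Variables (R : realType) (T : finType).

Definition dot (x y : T -> R) : R := \sum_t x t * y t.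

Definition conv_hull (J : finType) (p : J -> T -> R) (S : {set J}) :
    set (T -> R) :=
  [set x | exists c : J -> R,
    [/\ forall j, 0 <= c j, \sum_(j in S) c j = 1
      & forall t, x t = \sum_(j in S) c j * p j t]].

Definition aff_hull (K : set (T -> R)) : set (T -> R) :=
  [set x | exists m (c : 'I_m -> R) (p : 'I_m -> T -> R),
    [/\ forall j, K (p j), \sum_j c j = 1
      & forall t, x t = \sum_j c j * p j t]].

Definition rel_interior (K : set {ptws T -> R}) : set {ptws T -> R} :=
  [set x | K x /\ within (aff_hull K) (nbhs x) K].

Definition rel_boundary (K : set {ptws T -> R}) : set {ptws T -> R} :=
  closure K `\` rel_interior K.

Definition coord_bounded (K : set (T -> R)) : Prop :=
  exists M : R, forall x, K x -> forall t, `|x t| <= M.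

End Convex.

Definition argmin (R : realType) (J : finType) (f : J -> R) : {set J} :=
  [set j | [forall k, f j <= f k]].

(* Flow graphs with at least two vertices: the vertices 1, ..., n.+2 are
   represented by 0, ..., n.+1, so that ord0 is the source and ord_max the
   sink. Multiple edges are allowed since edges form a type of their own. *)

Record flow_graph (n : nat) := FlowGraph {
  edge : finType;
  src : edge -> 'I_n.+2;
  tgt : edge -> 'I_n.+2;
  edge_lt : forall e, (src e < tgt e)%N;
  unique_source : forall v, (forall e, tgt e != v) <-> v = ord0;
  unique_sink : forall v, (forall e, src e != v) <-> v = ord_max
}.

Section FlowGraph.
Variables (n : nat) (G : flow_graph n).
Local Notation V := 'I_n.+2.
Local Notation E := (edge G).

Definition In_ (v : V) : {set E} := [set e | tgt e == v].
Definition Out (v : V) : {set E} := [set e | src e == v].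

Definition inner (v : V) : bool := (v != ord0) && (v != ord_max).

Fixpoint dipath (u : V) (p : seq E) (v : V) : bool :=
  if p is e :: p' then (src e == u) && dipath (tgt e) p' v else u == v.

Lemma dipath_size u p v : dipath u p v -> (u + size p <= v)%N.
Proof.
elim: p u => [|e p IHp] u /=; first by move/eqP->; rewrite addn0.
case/andP=> /eqP<- /IHp; apply: leq_trans.
by rewrite addnS -addSn leq_add2r edge_lt.
Qed.

Lemma route_size p : dipath ord0 p ord_max -> (size p <= n.+1)%N.
Proof. exact: dipath_size. Qed.

(* The bound n.+1 on the length excludes no path (dipath_size); it only makes
   the types of paths below finite. *)
Definition route : finType :=
  {p : n.+1.-bseq E | dipath ord0 p ord_max}.

Definition redges (P : route) : seq E := val P.

Definition mk_route (p : seq E) (hp : dipath ord0 p ord_max) : route :=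
  Sub (Bseq (route_size hp)) hp.

(* For vertices w <= v of a path P, the edges of the subpath of P from w to
   v. *)
Definition segment (P : route) (w v : V) : seq E :=
  [seq e <- redges P | (w <= src e)%N && (tgt e <= v)%N].

Definition on_route (v : V) (P : route) : bool :=
  (v == ord0) || has (fun e => tgt e == v) (redges P).

Section Real.
Variable R : realType.

Definition indic (P : route) : E -> R := fun e => (e \in redges P)%:R.

Definition netflow (v : V) : R :=
  if v == ord0 then 1 else if v == ord_max then -1 else 0.

Definition flow_polytope : set (E -> R) :=
  [set x | (forall e, 0 <= x e) /\
    forall v, \sum_(e in Out v) x e - \sum_(e in In_ v) x e = netflow v].

(* The lower faces for - h, i.e. the upper faces for h. *)
Definition regular_subdivision (h : route -> R) : set (set (E -> R)) :=
  [set K | exists y : E -> R,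
    K = conv_hull indic (argmin (fun P => - h P + dot (indic P) y))].

End Real.

Definition linear_order_on (A : {set E}) (r : rel E) : Prop :=
  [/\ {in A, reflexive r}, {in A &, antisymmetric r},
      {in A & &, transitive r} & {in A &, total r}].

Record framing := Framing {
  le_in : V -> rel E;
  le_out : V -> rel E;
  le_in_linear : forall v, linear_order_on (In_ v) (le_in v);
  le_out_linear : forall v, linear_order_on (Out v) (le_out v)
}.

Section Framed.
Variable F : framing.

Definition lt_in (v : V) (e f : E) : bool := (e != f) && le_in F v e f.
Definition lt_out (v : V) (e f : E) : bool := (e != f) && le_out F v e f.

(* P and Q both pass through w <= v and have the same edges between w and v;
   then the minimal such w. *)
Definition coincide_from (P Q : route) (v w : V) : bool :=
  [&& (w <= v)%N, on_route w P, on_route w Q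
    & segment P w v == segment Q w v].

Definition in_split (P Q : route) (v w : V) : bool :=
  coincide_from P Q v w &&
  [forall u : V, coincide_from P Q v u ==> (w <= u)%N].

(* When w is the first vertex of a route there is no edge of that route
   entering w, so neither Pv < Qv nor Qv < Pv. *)
Definition in_lt (v : V) (P Q : route) : bool :=
  [exists w : V, in_split P Q v w &&
    [exists e in In_ w, exists f in In_ w,
      [&& e \in redges P, f \in redges Q & lt_in w e f]]].

Definition coincide_to (P Q : route) (v w : V) : bool :=
  [&& (v <= w)%N, on_route w P, on_route w Q
    & segment P v w == segment Q v w].

Definition out_split (P Q : route) (v w : V) : bool :=
  coincide_to P Q v w &&
  [forall u : V, coincide_to P Q v u ==> (u <= w)%N].

Definition out_lt (v : V) (P Q : route) : bool :=
  [exists w : V, out_split P Q v w &&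
    [exists e in Out w, exists f in Out w,
      [&& e \in redges P, f \in redges Q & lt_out w e f]]].

Definition incoherent_at (v : V) (P Q : route) : bool :=
  (in_lt v P Q && out_lt v Q P) || (in_lt v Q P && out_lt v P Q).

Definition coherent (P Q : route) : bool :=
  [forall v : V, [&& inner v, on_route v P & on_route v Q] ==>
    ~~ incoherent_at v P Q].

Definition clique (S : {set route}) : bool :=
  [forall P in S, forall Q in S, coherent P Q].

(* The label j of an edge e_{i,j}: the outgoing edges at a vertex are numbered
   from 0 in decreasing framing order. *)
Definition label (e : E) : nat :=
  #|[set f in Out (src e) | lt_out (src e) e f]|.

(* The index set {(i,j) : 1 <= i <= n-2, 1 <= j <= j_i} of the tropical
   arrangement, where (i,j) is identified with the edge e_{i,j}. *)
Definition trop_index : finType :=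
  {e : E | inner (src e) && (0 < label e)%N}.

Definition source_edge : finType := {e : E | e \in Out ord0}.

(* The edge sets of \hat G_i and of G_i. *)
Definition hat_edges (a : source_edge) : {set E} :=
  [set e | [exists P : route,
    (ohead (redges P) == Some (val a)) && (e \in redges P)]].

Definition sub_edges (a : source_edge) : {set E} := hat_edges a :\ val a.

Definition subroute (a : source_edge) : finType :=
  {p : n.+1.-bseq E |
    dipath (tgt (val a)) p ord_max && all (mem (sub_edges a)) p}.

Lemma prepend_dipath (a : source_edge) (Q : subroute a) :
  dipath ord0 (val a :: val Q) ord_max.
Proof.
rewrite /=; have := valP a; rewrite inE => ->.
by have /andP[] := valP Q.
Qed.

Definition prepend (a : source_edge) (Q : subroute a) : route :=
  mk_route (prepend_dipath Q).

Section Tropical.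
Variables (R : realType) (h : route -> R).

(* The empty clique is left out: faces are nonempty. *)
Definition framed_triangulation : set (set (E -> R)) :=
  [set K | exists S : {set route},
    [/\ clique S, S != finset.set0 & K = conv_hull (@indic R) S]].

Definition interior_face : set (set (E -> R)) :=
  [set K | framed_triangulation K /\
    ~ (K `<=` rel_boundary (@flow_polytope R))].

Definition admissible : Prop :=
  regular_subdivision h = framed_triangulation.

Definition trop_vec (a : source_edge) (Q : subroute a) : trop_index -> R :=
  fun i => (val i \in (val Q : seq E))%:R.

(* The terms whose minimum is T_a(x). *)
Definition trop_term (a : source_edge) (x : trop_index -> R)
    (Q : subroute a) : R :=
  - h (prepend Q) + dot (trop_vec Q) x.

Definition hypersurface_cell (a : source_edge) : set (set (trop_index -> R)) :=
  [set C | exists A : {set subroute a},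
    [/\ A != finset.set0, C !=set0
      & C = [set x | A \subset argmin (trop_term x)]]].

Definition trop_cell : set (set (trop_index -> R)) :=
  [set C | C !=set0 /\
    exists2 D : source_edge -> set (trop_index -> R),
      forall a, hypersurface_cell a (D a) & C = \bigcap_a D a].

Definition bounded_trop_cell : set (set (trop_index -> R)) :=
  [set C | trop_cell C /\ coord_bounded C].

End Tropical.
End Framed.
End FlowGraph.

Definition poset_isomorphic (A B : Type) (leA : A -> A -> Prop)
    (leB : B -> B -> Prop) : Prop :=
  exists2 f : A -> B, bijective f & forall x y, leA x y <-> leB (f x) (f y).

(* The carriers are ordered by inclusion and by reverse inclusion. *)
Definition tropical_framingtope (n : nat) (G : flow_graph n) (F : framing G)
    (R : realType) (h : route G -> R) : Type :=
  {C : set (trop_index F -> R) | bounded_trop_cell h C}.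

Definition combinatorial_framingtope (n : nat) (G : flow_graph n)
    (F : framing G) (R : realType) : Type :=
  {K : set (edge G -> R) | interior_face F K}.

Definition le_tropical (n : nat) (G : flow_graph n) (F : framing G)
    (R : realType) (h : route G -> R) (C D : tropical_framingtope F h) : Prop :=
  sval C `<=` sval D.

Definition le_combinatorial (n : nat) (G : flow_graph n) (F : framing G)
    (R : realType) (K L : combinatorial_framingtope F R) : Prop :=
  sval L `<=` sval K.

(* Main.v *)
Require Import Defs.
From mathcomp Require Import all_boot all_order all_algebra.
From mathcomp Require Import reals boolp classical_sets topology normedtype.
From mathcomp Require Import lra.

(** Both posets are the set of cliques that use every edge of [G], ordered by
    reverse inclusion.

    Write [cost y P] for [- h P] plus the sum of [y] along the route [P].
    Admissibility says that the sets of routes of minimal cost, for varying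
    edge weights [y], are exactly the nonempty cliques: a face is the convex
    hull of indicator vectors, and it determines the set of these vectors
    (conv_hull_indic_inj).

    A point [x] of the tropical arrangement is a weight function supported on
    the inner edges with nonzero label, and the tropical cell of [x] records,
    for each source edge separately, the routes of minimal cost among those
    that start with this edge; let [fibre_argmin x] be the set of all these
    routes. Replacing the zero weight of each source edge by minus the minimum
    that it achieves makes all these minima vanish, so that
    [fibre_argmin x] is the set of routes minimising one global cost
    (fibre_argmin_lift) and hence a clique, which contains a route through
    every source edge.
    Conversely, adding a potential difference to a weight function changes
    the cost of all routes by a common constant. The edges of label 0 form a
    tree directed to the sink, so a suitable potential makes the weight vanish
    on those of them that leave inner vertices, and the weights of the source
    edges only matter for comparing different fibres. Hence each clique which
    meets every source edge is some [fibre_argmin x] (clique_fibre_argmin).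
    The tropical cells are therefore the sets
    [clique_cell S = [set x | S \subset fibre_argmin x]], one for each clique
    [S] meeting all source edges, and they reverse inclusion (trop_cellP,
    clique_cell_subset).

    Such a cell is bounded exactly when [S] uses every edge. If it does,
    splice routes of [S]: two beginnings of such routes which end at
    the same vertex have almost the same weight, up to a constant that depends
    only on [h]; going backwards from the sink along edges of label 0, whose
    weight vanishes, bounds all the weights of beginnings, hence all
    coordinates (covers_bounded). If some edge is not used, making it more
    expensive does not affect the routes of [S], and this gives a direction in
    which the cell recedes; the direction is nonzero for an unused edge with
    smallest possible tail (bounded_covers).

    On the other side, the relative interior of the flow polytope consists of
    the flows that are positive on every edge, so a face is interior exactly
    when its clique uses every edge (interior_faceP). *)

Set Implicit Arguments.
Unset Strict Implicit.
Unset Printing Implicit Defensive.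

Import Order.TTheory GRing.Theory Num.Theory.
Import numFieldNormedType.Exports.

Local Open Scope classical_set_scope.
Local Open Scope ring_scope.

(** * Convex hulls and pointwise convergence *)

Section FunctionSpace.
Variables (R : realType) (T : finType).

Lemma sum1_nonneg_ex (J : finType) (S : {set J}) (c : J -> R) :
  (forall j, 0 <= c j) -> \sum_(j in S) c j = 1 ->
  exists2 j, j \in S & 0 < c j.
Proof.
move=> c0 c1.
have [|j /andP[jS cj]] := @psumr_neq0P _ _ (mem S) c (fun j _ => c0 j).
  by rewrite c1; apply/eqP/oner_neq0.
by exists j.
Qed.

Lemma conv_hull_vertex (J : finType) (p : J -> T -> R) (S : {set J}) j :
  j \in S -> conv_hull p S (p j).
Proof.
move=> jS; exists (fun k => (k == j)%:R); split=> [k||e].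
- exact: ler0n.
- rewrite (bigD1 j) //= eqxx big1 ?addr0 // => k /andP[_ /negPf->] //.
- rewrite (bigD1 j) //= eqxx mul1r big1 ?addr0 // => k /andP[_ /negPf->].
  by rewrite mul0r.
Qed.

Lemma conv_hull_mono (J : finType) (p : J -> T -> R) (A B : {set J}) :
  A \subset B -> conv_hull p A `<=` conv_hull p B.
Proof.
move=> /fintype.subsetP AB x [c [c0 c1 xE]].
have restrict (g : J -> R) : \sum_(j in B) (if j \in A then g j else 0) =
    \sum_(j in A) g j.
  rewrite -big_mkcondr; apply: eq_bigl => j.
  by rewrite andbC; case: (boolP (j \in A)) => //= /AB.
exists (fun j => if j \in A then c j else 0); split=> [j||e].
- by case: ifP.
- by rewrite restrict.
rewrite xE -restrict; apply: eq_bigr => j _.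
by case: ifP; rewrite ?mul0r.
Qed.

Lemma ptws_continuous (S : topologicalType) (f : S -> {ptws T -> R}) :
  (forall e, continuous (fun t => f t e)) -> continuous f.
Proof.
move=> fc t; apply/cvg_sup => e.
exact: (@continuous_comp_initial _ S R (fun x : {ptws T -> R} => x e) f (fc e)).
Qed.

Lemma near_ptws_pos (x : {ptws T -> R}) : (forall e, 0 < x e) ->
  \forall z \near x, forall e, 0 < z e.
Proof.
move=> x0; apply: (@filter_forall _ T (fun e (z : {ptws T -> R}) => 0 < z e)
  (nbhs x) (nbhs_filter x)) => e.
have := @proj_continuous T (fun=> R) e x [set r | 0 < r]; apply.
exact: lt_nbhsr (x0 e).
Qed.

End FunctionSpace.

(** * Directed paths and routes *)

Section Paths.
Variables (n : nat) (G : flow_graph n).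
Local Notation V := 'I_n.+2.
Local Notation E := (edge G).
Implicit Types (u v w : V) (e f : E) (p q : seq E) (P Q : route G).

Lemma dipath_cat u p q w :
  dipath u (p ++ q) w <-> exists2 v, dipath u p v & dipath v q w.
Proof.
elim: p u => [|e p IHp] u /=.
  by split=> [pq|[v /eqP-> //]]; exists u.
split=> [/andP[-> /IHp[v pv vq]]|[v /andP[-> pv] vq]]; first by exists v.
by apply/IHp; exists v.
Qed.

Lemma dipath_cat_cons u p e q w :
  dipath u (p ++ e :: q) w = dipath u p (src e) && dipath (tgt e) q w.
Proof.
apply/idP/andP=> [/dipath_cat[v pv /= /andP[/eqP-> ->]] //|[pe eq]].
by apply/dipath_cat; exists (src e) => //=; rewrite eqxx.
Qed.

Lemma dipath_le u p v : dipath u p v -> (u <= v)%N.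
Proof. by move/dipath_size; apply: leq_trans; rewrite leq_addr. Qed.

Lemma dipath_src_ge u p v e : dipath u p v -> e \in p -> (u <= src e)%N.
Proof.
move=> pv ep; case/path.splitPr: ep pv => p1 p2.
by rewrite dipath_cat_cons => /andP[/dipath_le].
Qed.

Lemma dipath_uniq u p v : dipath u p v -> uniq p.
Proof.
elim: p u => [|e p IHp] u //= /andP[_ pv]; rewrite (IHp _ pv) andbT.
by apply/negP=> /(dipath_src_ge pv); rewrite leqNgt edge_lt.
Qed.

Lemma dipath_telescope (U : zmodType) (phi : V -> U) u p v : dipath u p v ->
  \sum_(e <- p) (phi (tgt e) - phi (src e)) = phi v - phi u.
Proof.
elim: p u => [|e p IHp] u /=; first by move/eqP->; rewrite big_nil subrr.
by case/andP=> /eqP<- /IHp; rewrite big_cons => ->; rewrite addrC subrKA.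
Qed.

(** A directed path is determined by its set of edges: tails strictly increase
    along a path, so at most one of its edges leaves a given vertex. *)
Lemma dipath_subset_eq u p q v : dipath u p v -> dipath u q v ->
  {subset q <= p} -> q = p.
Proof.
elim: p u q => [|e p IHp] u [|f q] //=.
- by move=> _ _ /(_ f (mem_head _ _)).
- move=> /andP[/eqP<- /dipath_le lt1] /eqP eu.
  by move: lt1; rewrite -eu leqNgt edge_lt.
move=> /andP[/eqP eu pv] /andP[/eqP fu qv] sub.
have fE : f = e.
  have /[!inE]/predU1P[//|/(dipath_src_ge pv)] := sub f (mem_head _ _).
  by rewrite fu -eu leqNgt edge_lt.
subst f; congr cons; apply: (IHp _ _ pv qv) => g gq.
have /[!inE]/predU1P[ge|//] := sub g (mem_behead (s := e :: q) gq).
by move: (dipath_src_ge qv gq); rewrite ge leqNgt edge_lt.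
Qed.

Lemma ord_max_neq0 : ord_max != ord0 :> V.
Proof. by []. Qed.

Lemma has_in_edge v : v != ord0 -> exists e : E, tgt e = v.
Proof.
move=> /eqP v0; apply/not_existsP => noe; apply: v0.
by apply/(unique_source G v) => e; apply/eqP/noe.
Qed.

Lemma has_out_edge v : v != ord_max -> exists e : E, src e = v.
Proof.
move=> /eqP v0; apply/not_existsP => noe; apply: v0.
by apply/(unique_sink G v) => e; apply/eqP/noe.
Qed.

Lemma src_neq_max e : src e != ord_max.
Proof. by have := (unique_sink G ord_max).2 erefl e. Qed.

Lemma tgt_neq0 e : tgt e != ord0.
Proof. by have := (unique_source G ord0).2 erefl e. Qed.

Lemma inner_src e : inner (src e) = (src e != ord0).
Proof. by rewrite /inner src_neq_max andbT. Qed.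

Lemma dipath_src_neq0 u p v e : u != ord0 -> dipath (G := G) u p v ->
  e \in p -> src e != ord0.
Proof.
move=> u0 pv ep; apply: contra u0 => /eqP e0.
by have := dipath_src_ge pv ep; rewrite e0 leqn0.
Qed.

Lemma vertex_ind_down (K : V -> Prop) :
  (forall v, (forall u, (v < u)%N -> K u) -> K v) -> forall v, K v.
Proof.
move=> H v; have [m] := ubnP (n.+2 - v); elim: m v => // m IHm v lev.
apply: H => u vu; apply: IHm.
by apply: leq_trans (ltn_sub2l (ltn_ord v) vu) lev.
Qed.

Lemma vertex_ind_up (K : V -> Prop) :
  (forall v, (forall u, (u < v)%N -> K u) -> K v) -> forall v, K v.
Proof.
move=> H v; have [m] := ubnP v; elim: m v => // m IHm v lev.
by apply: H => u uv; apply: IHm; exact: leq_trans uv lev.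
Qed.

Lemma path_from_source v : exists p : seq E, dipath ord0 p v.
Proof.
elim/vertex_ind_up: v => v IHv; have [->|/has_in_edge[e ev]] := eqVneq v ord0.
  by exists [::] => /=.
have [|p pe] := IHv (src e); first by rewrite -ev edge_lt.
by exists (p ++ [:: e]); rewrite dipath_cat_cons pe /= ev.
Qed.

Lemma path_to_sink v : exists p : seq E, dipath v p ord_max.
Proof.
elim/vertex_ind_down: v => v IHv.
have [->|/has_out_edge[e ev]] := eqVneq v ord_max; first by exists [::] => /=.
have [|p pe] := IHv (tgt e); first by rewrite -ev edge_lt.
by exists (e :: p) => /=; rewrite ev eqxx.
Qed.

Lemma redges_dipath P : dipath ord0 (redges P) ord_max.
Proof. exact: valP P. Qed.

Lemma redges_mk p (hp : dipath (G := G) ord0 p ord_max) :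
  redges (mk_route hp) = p.
Proof. by []. Qed.

Lemma redges_uniq P : uniq (redges P).
Proof. exact: dipath_uniq (redges_dipath P). Qed.

Lemma redges_inj : injective (@redges n G).
Proof. by move=> P Q PQ; apply/val_inj/val_inj. Qed.

Lemma route_subset_eq P Q : {subset redges Q <= redges P} -> Q = P.
Proof.
by move/(dipath_subset_eq (redges_dipath P) (redges_dipath Q))/redges_inj.
Qed.

Lemma route_through e : exists P, e \in redges P.
Proof.
have [p pe] := path_from_source (src e); have [q eq] := path_to_sink (tgt e).
have pq : dipath ord0 (p ++ e :: q) ord_max by rewrite dipath_cat_cons pe eq.
by exists (mk_route pq); rewrite redges_mk mem_cat mem_head orbT.
Qed.

Lemma route_head P : exists e p, redges P = e :: p.
Proof.
have := redges_dipath P; case: (redges P) => [/= /eqP e0|e p _].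
  by have := ord_max_neq0; rewrite -e0 eqxx.
by exists e, p.
Qed.

Lemma route_split P e : e \in redges P -> exists p q,
  [/\ redges P = p ++ e :: q, dipath ord0 p (src e)
    & dipath (tgt e) q ord_max].
Proof.
move=> eP; have := redges_dipath P; case/path.splitPr: eP => p q.
by rewrite dipath_cat_cons => /andP[pe eq]; exists p, q.
Qed.

(** No edge enters the source, so a route uses exactly one source edge. *)
Lemma source_edge_head P e :
  (src e == ord0) && (e \in redges P) = (ohead (redges P) == Some e).
Proof.
have [f [p Pf]] := route_head P; have := redges_dipath P; rewrite Pf /=.
case/andP=> /eqP f0 pv; rewrite (inj_eq Some_inj) inE (eq_sym e).
apply/andP/eqP=> [[/eqP e0 /orP[/eqP->//|ep]]|<-]; last by rewrite f0 !eqxx.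
by have := leq_trans (edge_lt f) (dipath_src_ge pv ep); rewrite e0.
Qed.

End Paths.

(** * Interior faces *)

Section Interior.
Variables (n : nat) (G : flow_graph n) (R : realType).
Local Notation V := 'I_n.+2.
Local Notation E := (edge G).
Implicit Types (P Q : route G) (S T : {set route G}).

Lemma dot_indic P y : dot (indic R P) y = \sum_(e <- redges P) y e.
Proof.
rewrite /dot /indic (big_uniq _ (redges_uniq P)) [RHS]big_mkcond /=.
by apply: eq_bigr => e _; case: ifP => _; rewrite ?mul1r ?mul0r.
Qed.

(** Flow conservation at [v] is the telescoping sum, along the route, of the
    indicator function of [v]. *)
Lemma indic_flow P : flow_polytope (indic R P).
Proof.
split=> [e|v]; first by rewrite /indic ler0n.
have sumE (A : {set E}) : \sum_(e in A) indic R P e =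
    \sum_(e <- redges P) (e \in A)%:R.
  rewrite -dot_indic /dot big_mkcond; apply: eq_bigr => e _.
  by case: ifP; rewrite ?mulr1 ?mulr0.
rewrite !sumE -sumrB.
under eq_bigr => e _ do rewrite !inE addrC -[X in _ + X]opprK.
rewrite (dipath_telescope (fun u => - (u == v)%:R) (redges_dipath P)).
rewrite opprK addrC /netflow ![_ == v]eq_sym.
have [->|_] := eqVneq v ord0.
  by rewrite eq_sym (negPf (ord_max_neq0 _)) subr0.
by case: eqVneq; rewrite ?sub0r ?oppr0 ?addr0.
Qed.

(** If [P] is a convex combination of routes, then each route [Q] occurring in
    it vanishes off the edges of [P], so that [Q = P]. *)
Lemma conv_hull_indicP (S T : {set route G}) :
  (conv_hull (indic R) S `<=` conv_hull (indic R) T) <-> S \subset T.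
Proof.
split=> [sub|]; last exact: conv_hull_mono.
apply/fintype.subsetP => P PS.
have [c [c0 c1 PE]] := sub _ (conv_hull_vertex (indic R) PS).
have [Q QT cQ] := sum1_nonneg_ex c0 c1.
suff <- : Q = P by [].
apply: route_subset_eq => e eQ; apply: contraT => eP.
have := PE e; rewrite /indic (negPf eP) (bigD1 Q) //= eQ mulr1.
move=> /esym/eqP; rewrite paddr_eq0 ?(gt_eqF cQ) //.
by apply: sumr_ge0 => Q' _; rewrite mulr_ge0.
Qed.

Lemma conv_hull_indic_inj (S T : {set route G}) :
  conv_hull (indic R) S = conv_hull (indic R) T -> S = T.
Proof.
move=> ST; apply/eqP; rewrite finset.eqEsubset.
by apply/andP; split; apply/conv_hull_indicP; rewrite ST.
Qed.

Definition conserves (x : E -> R) : Prop := forall v : V,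
  \sum_(e in Out G v) x e - \sum_(e in In_ G v) x e = netflow R v.

(** Stated for signed coefficients, to cover convex and affine hulls alike. *)
Lemma conserves_affine (J : finType) (A : pred J) (c : J -> R)
    (p : J -> E -> R) (x : E -> R) :
  (forall j, A j -> conserves (p j)) -> \sum_(j | A j) c j = 1 ->
  (forall e, x e = \sum_(j | A j) c j * p j e) -> conserves x.
Proof.
move=> pA c1 xE v.
have sumE (B : {set E}) : \sum_(e in B) x e =
    \sum_(j | A j) c j * \sum_(e in B) p j e.
  under eq_bigr do rewrite xE.
  by rewrite exchange_big /=; apply: eq_bigr => j _; rewrite mulr_sumr.
rewrite !sumE -sumrB -[RHS]mul1r -c1 mulr_suml; apply: eq_bigr => j Aj.
by rewrite -mulrBr pA.
Qed.

Lemma conv_hull_flow (S : {set route G}) :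
  conv_hull (indic R) S `<=` @flow_polytope n G R.
Proof.
move=> x [c [c0 c1 xE]]; split=> [e|].
  by rewrite xE sumr_ge0 // => P _; rewrite mulr_ge0 // ler0n.
apply: conserves_affine c1 xE => P _; exact: (indic_flow P).2.
Qed.

Lemma aff_hull_conserves : aff_hull (@flow_polytope n G R) `<=` conserves.
Proof.
move=> x [m [c [p [pF c1 xE]]]].
by apply: (@conserves_affine _ xpredT c p) => // j _; exact: (pF j).2.
Qed.

Definition covers (n : nat) (G : flow_graph n) (S : {set route G}) : Prop :=
  forall e, exists2 P, P \in S & e \in redges P.

(** The barycentre of a covering set of routes is a flow that is positive on
    every edge, and nonnegativity on the edges is the only condition besides
    those that define the affine hull. *)
Lemma covers_interior (S : {set route G}) : covers S ->
  ~ conv_hull (indic R) S `<=` rel_boundary (@flow_polytope n G R).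
Proof.
move=> cov sub.
have [e0 _] := @has_out_edge n G ord0 isT; have [P0 P0S _] := cov e0.
have S0 : (0 < #|S|)%N by apply/card_gt0P; exists P0.
have S0R : 0 < #|S|%:R^-1 :> R by rewrite invr_gt0 ltr0n.
pose x : E -> R := fun e => \sum_(P in S) #|S|%:R^-1 * indic R P e.
have xS : conv_hull (indic R) S x.
  exists (fun=> #|S|%:R^-1); split=> // [j|]; first exact: ltW.
  by rewrite sumr_const -[LHS]mulr_natl mulfV // pnatr_eq0 -lt0n.
have [_ []] := sub x xS; split; first exact: conv_hull_flow xS.
have x0 e : 0 < x e.
  have [P PS eP] := cov e; rewrite /x (bigD1 P) //= /indic eP mulr1.
  rewrite ltr_wpDr // sumr_ge0 // => Q _.
  by rewrite mulr_ge0 ?ler0n // ltW.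
have sub_pos : [set z : {ptws E -> R} | forall e, 0 < z e] `<=`
    [set z | aff_hull (@flow_polytope n G R) z -> flow_polytope z].
  move=> z z0 /aff_hull_conserves zc.
  by split=> // e; apply: ltW.
exact: (@filterS _ _ (nbhs_filter (x : {ptws E -> R})) _ _ sub_pos
  (near_ptws_pos x0)).
Qed.

(** At a point of the hull, an edge [e] missed by [S] carries no flow. Moving
    away from a route through [e] stays in the affine hull but makes the flow
    on [e] negative at once. *)
Lemma not_covers_boundary (S : {set route G}) : ~ covers S ->
  conv_hull (indic R) S `<=` rel_boundary (@flow_polytope n G R).
Proof.
move=> /existsNP[e ncov] x xS; have xF := conv_hull_flow xS.
have xe : x e = 0.
  have [c [_ _ ->]] := xS; apply: big1 => P PS.
  rewrite /indic; have [eP|] := boolP (e \in redges P); last by rewrite mulr0.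
  by case: ncov; exists P.
split; first exact: subset_closure xF.
move=> [_ Hx]; have [P eP] := route_through e.
(* The affine combination with coefficients [1 + t] and [- t]. *)
pose z t : {ptws E -> R} := fun f => x f + t * (x f - indic R P f).
have zc : continuous z.
  apply: ptws_continuous => f t; apply: cvgD; first exact: cvg_cst.
  by apply: cvgM; [exact: cvg_id | exact: cvg_cst].
have z0 : z 0 = x by apply/funext => f; rewrite /z mul0r addr0.
have zaff t : aff_hull (@flow_polytope n G R) (z t).
  exists 2%N, (fun j : 'I_2 => if j == ord0 then 1 + t else - t),
    (fun j : 'I_2 => if j == ord0 then x else indic R P).
  split=> [j||f]; first by case: ifP => _ //; exact: indic_flow.
    by rewrite big_ord_recl big_ord1 /=; lra.
  by rewrite big_ord_recl big_ord1 /= /z; lra.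
have Hz : \forall t \near 0, aff_hull (@flow_polytope n G R) (z t) ->
    flow_polytope (z t).
  have z0cvg : z @ (0 : R) --> (x : {ptws E -> R}) by rewrite -z0; exact: zc.
  exact: z0cvg Hx.
have near0 : \forall t \near 0^'+, flow_polytope (z t).
  by apply: filterS Hz => t Ht _; apply: Ht.
have [t [t0 [/(_ e) + _]]] := filter_ex (filterI (nbhs_right_gt 0) near0).
by rewrite /z xe add0r sub0r /indic eP mulrN1 oppr_ge0 leNgt t0.
Qed.

Lemma interior_faceP (F : framing G) (K : set (E -> R)) : interior_face F K <->
  exists S, [/\ clique F S, covers S & K = conv_hull (indic R) S].
Proof.
split=> [[[S [S_clique _ ->]] notbd]|[S [S_clique cov ->]]].
  exists S; split=> //; apply: contrapT => /not_covers_boundary.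
  exact: notbd.
split; last exact: covers_interior.
exists S; split=> //; have [e0 _] := @has_out_edge n G ord0 isT.
by have [P PS _] := cov e0; apply/set0Pn; exists P.
Qed.

End Interior.

(** * Bottom paths and normalisation of edge weights *)

Section Framed.
Variables (n : nat) (G : flow_graph n) (F : framing G).
Local Notation V := 'I_n.+2.
Local Notation E := (edge G).
Implicit Types (u v w : V) (e f : E) (p q : seq E) (P Q : route G).

Lemma lt_out_trans e f g : src e = src f -> src f = src g ->
  lt_out F (src e) e f -> lt_out F (src e) f g -> lt_out F (src e) e g.
Proof.
case: (le_out_linear F (src e)) => _ asym trans _ ef fg.
have [eO fO gO] :
    [/\ e \in Out G (src e), f \in Out G (src e) & g \in Out G (src e)].
  by rewrite !inE -fg -ef eqxx.
move=> /andP[nef lef] /andP[nfg lfg].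
rewrite /lt_out (trans f e g) // andbT; apply: contra nef => /eqP eg.
by move: lfg; rewrite -eg => lfe; apply/eqP/asym; rewrite ?lef.
Qed.

(** An edge of minimal label at [v] has label 0: an edge above it in the
    framing order would have a smaller label. *)
Lemma bottom_edge v : v != ord_max -> exists2 e, src e = v & label F e = 0%N.
Proof.
case/(@has_out_edge _ G) => e0 e0v.
have [e] := @arg_minnP _ e0 (fun e => src e == v) (label F) (introT eqP e0v).
move=> /eqP ev min_e; exists e => //.
apply/eqP; rewrite cards_eq0; apply/eqP/setP => f; rewrite !inE.
apply/negbTE/negP => /andP[/eqP fe ef].
have := min_e f; rewrite fe ev eqxx => /(_ isT); rewrite leqNgt => /negP; apply.
rewrite /label fe ev proper_card //; apply/properP; split.
  apply/fintype.subsetP => g; rewrite !inE => /andP[/eqP gv fg].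
  rewrite gv eqxx /= -ev; apply: (lt_out_trans (f := f)) => //.
    by rewrite fe gv.
  by rewrite ev.
exists f; rewrite !inE fe ev eqxx //=; first by rewrite -ev.
by rewrite /lt_out eqxx.
Qed.

Lemma bottom_edge_unique e f :
  src e = src f -> label F e = 0%N -> label F f = 0%N -> e = f.
Proof.
move=> ef /eqP + /eqP; rewrite !cards_eq0 => /eqP/setP e0 /eqP/setP f0.
apply/eqP/negPn/negP => nef.
have := e0 f; have := f0 e; rewrite !inE /lt_out ef eqxx /= eq_sym nef /=.
case: (le_out_linear F (src f)) => _ _ _ /(_ e f).
by rewrite !inE ef eqxx => /(_ isT isT) /orP[->|->].
Qed.

Lemma bottom_path_exists v : exists p,
  dipath v p ord_max /\ all (fun e => label F e == 0%N) p.
Proof.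
elim/vertex_ind_down: v => v IHv.
have [->|/bottom_edge[e ev e0]] := eqVneq v ord_max.
  by exists [::]; rewrite /= eqxx.
have [|p [pe p0]] := IHv (tgt e); first by rewrite -ev edge_lt.
by exists (e :: p); rewrite /= ev eqxx e0.
Qed.

Definition bottom_path v : seq E := sval (cid (bottom_path_exists v)).

Lemma bottom_path_dipath v : dipath v (bottom_path v) ord_max.
Proof. by rewrite /bottom_path; case: cid => p /= []. Qed.

Lemma bottom_path_label v : all (fun e => label F e == 0%N) (bottom_path v).
Proof. by rewrite /bottom_path; case: cid => p /= []. Qed.

Lemma bottom_path_sink : bottom_path ord_max = [::].
Proof.
have := bottom_path_dipath ord_max; case: (bottom_path _) => //= e p.
by rewrite (negPf (src_neq_max e)).
Qed.

Lemma bottom_path_unique u p q : dipath u p ord_max -> dipath u q ord_max ->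
  all (fun e => label F e == 0%N) p -> all (fun e => label F e == 0%N) q ->
  p = q.
Proof.
elim: p u q => [|e p IHp] u [|f q] //=.
- by move=> /eqP-> /andP[]; rewrite (negPf (src_neq_max f)).
- by move=> /andP[/eqP<- _]; rewrite (negPf (src_neq_max e)).
move=> /andP[/eqP eu pe] /andP[/eqP fu qf] /andP[/eqP e0 p0] /andP[/eqP f0 q0].
have ef : e = f by apply: bottom_edge_unique; rewrite // eu.
by subst f; congr cons; apply: (IHp _ _ pe).
Qed.

Lemma bottom_path_cons e : label F e = 0%N ->
  bottom_path (src e) = e :: bottom_path (tgt e).
Proof.
move=> e0; apply: (@bottom_path_unique (src e)); rewrite /= ?eqxx ?e0 //=.
- exact: bottom_path_dipath.
- exact: bottom_path_dipath.
- exact: bottom_path_label.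
- exact: bottom_path_label.
Qed.

Lemma inner_src_trop e : src e != ord0 -> label F e != 0%N ->
  exists i : trop_index F, val i = e.
Proof.
move=> es el; have ei : inner (src e) && (0 < label F e)%N.
  by rewrite inner_src es lt0n.
by exists (Sub e ei : trop_index F).
Qed.

Variable R : realType.
Implicit Types (y z : E -> R) (x : trop_index F -> R).

Definition potential y v : R := \sum_(e <- bottom_path v) y e.

(** The potential difference added here makes the weight of every edge of
    label 0 vanish (bottom_path_cons), which is why the coordinates on these
    edges can be dropped. *)
Definition normalise y : trop_index F -> R :=
  fun i => y (val i) + potential y (tgt (val i)) - potential y (src (val i)).

Definition extend x : E -> R := fun e => oapp x 0 (insub e).

Lemma extend_val x (i : trop_index F) : extend x (val i) = x i.
Proof. by rewrite /extend valK. Qed.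

Lemma extend_source x e : src e = ord0 -> extend x e = 0.
Proof. by move=> e0; rewrite /extend insubN // inner_src e0 eqxx. Qed.

Lemma extend_bottom x e : label F e = 0%N -> extend x e = 0.
Proof. by move=> e0; rewrite /extend insubN // e0 ltnn andbF. Qed.

Lemma extend_normalise y e : src e != ord0 ->
  extend (normalise y) e = y e + potential y (tgt e) - potential y (src e).
Proof.
move=> es; have [e0|e0] := eqVneq (label F e) 0%N.
  rewrite extend_bottom // /potential (bottom_path_cons e0) big_cons.
  by rewrite subrr.
by have [i <-] := inner_src_trop es e0; rewrite extend_val.
Qed.

(** Normalisation changes the weight of a route by an amount that depends only
    on its source edge. *)
Lemma sum_normalise y P a p : redges P = a :: p ->
  \sum_(e <- redges P) extend (normalise y) e =
  \sum_(e <- redges P) y e - (y a + potential y (tgt a)).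
Proof.
move=> Pap; have := redges_dipath P; rewrite Pap /= !big_cons.
case/andP=> /eqP a0 pv; rewrite extend_source // add0r.
transitivity (\sum_(e <- p)
    (y e + (potential y (tgt e) - potential y (src e)))).
  apply: eq_big_seq => e ep; rewrite extend_normalise ?addrA //.
  exact: dipath_src_neq0 (tgt_neq0 a) pv ep.
rewrite big_split /= (dipath_telescope _ pv) /potential.
rewrite bottom_path_sink big_nil.
by rewrite opprD addrACA subrr !add0r.
Qed.

(** * Routes of minimal cost in each source fibre *)

Definition cost (h : route G -> R) y P : R := - h P + \sum_(e <- redges P) y e.

Variable h : route G -> R.
Implicit Types S T : {set route G}.

Definition fibre_argmin x : {set route G} :=
  [set P | [forall Q, (ohead (redges Q) == ohead (redges P)) ==>
     (cost h (extend x) P <= cost h (extend x) Q)]].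

Lemma fibre_argminP x P : reflect
  (forall Q, ohead (redges Q) = ohead (redges P) ->
     cost h (extend x) P <= cost h (extend x) Q)
  (P \in fibre_argmin x).
Proof.
rewrite inE; apply: (iffP forallP) => H Q.
  by move=> /eqP QP; apply: (implyP (H Q)).
by apply/implyP => /eqP /H.
Qed.

Definition meets_source_edges (S : {set route G}) : Prop :=
  forall e, src e = ord0 -> exists2 P, P \in S & e \in redges P.

Lemma argminP y P : reflect (forall Q, cost h y P <= cost h y Q)
  (P \in argmin (cost h y)).
Proof. by rewrite inE; apply: forallP. Qed.

Lemma cost_normalise y P a p : redges P = a :: p ->
  cost h (extend (normalise y)) P = cost h y P - (y a + potential y (tgt a)).
Proof. by move=> Pap; rewrite /cost (sum_normalise _ Pap) addrA. Qed.

(** When every source edge lies on a globally optimal route, the fibrewise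
    minima of the cost are all equal to the global one. *)
Lemma fibre_argmin_normalise y : meets_source_edges (argmin (cost h y)) ->
  fibre_argmin (normalise y) = argmin (cost h y).
Proof.
move=> meet; apply/setP => P; apply/fibre_argminP/argminP => [minP Q|minP Q].
  have [a [p Pap]] := route_head P.
  have /andP[/eqP a0 aP] : (src a == ord0) && (a \in redges P).
    by rewrite source_edge_head Pap.
  (* A globally optimal route that starts with the same edge as [P]. *)
  have [P' /argminP minP' aP'] := meet a a0.
  have headP' : ohead (redges P') = Some a.
    by apply/eqP; rewrite -source_edge_head a0 eqxx.
  have [b [q P'bq]] := route_head P'; move: (headP'); rewrite P'bq => -[ba].
  have := minP P'; rewrite headP' Pap => /(_ erefl).
  rewrite (cost_normalise _ Pap) (cost_normalise _ P'bq) ba lerD2r => PP'.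
  exact: le_trans PP' (minP' Q).
have [a [p Pap]] := route_head P; have [b [q Qbq]] := route_head Q.
rewrite Pap Qbq => -[ba]; rewrite (cost_normalise _ Pap) (cost_normalise _ Qbq).
by rewrite ba lerD2r.
Qed.

Lemma source_min x e : exists c : R, src e = ord0 ->
  (exists2 P, ohead (redges P) = Some e & cost h (extend x) P = c) /\
  forall P, ohead (redges P) = Some e -> c <= cost h (extend x) P.
Proof.
have [P0 eP0] := route_through e.
have [e0|ne0] := eqVneq (src e) ord0; last first.
  by exists 0 => e0; rewrite e0 eqxx in ne0.
have headP0 : ohead (redges P0) == Some e.
  by rewrite -source_edge_head e0 eqxx.
have [P /eqP headP minP] := @arg_minP _ _ _ P0
  (fun P => ohead (redges P) == Some e) (cost h (extend x)) headP0.
exists (cost h (extend x) P) => _; split; first by exists P.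
by move=> Q /eqP /minP.
Qed.

(** The weights of the source edges are chosen so that the minimal cost in
    each fibre becomes 0; the fibrewise minima then form one global minimum. *)
Lemma fibre_argmin_lift x : exists y,
  [/\ forall e, src e != ord0 -> y e = extend x e,
      forall P, h P <= \sum_(e <- redges P) y e,
      forall P, P \in fibre_argmin x <-> \sum_(e <- redges P) y e = h P
    & meets_source_edges (fibre_argmin x)].
Proof.
have [m mP] := choice (source_min x).
(* [m e] is the minimal cost in the fibre of the source edge [e]. *)
pose y e := if src e == ord0 then - m e else extend x e.
have yE P a p : redges P = a :: p ->
    [/\ src a = ord0, ohead (redges P) = Some a
      & \sum_(e <- redges P) y e = h P + (cost h (extend x) P - m a)].
  move=> Pap; have := redges_dipath P; rewrite /cost Pap /= !big_cons.
  case/andP=> /eqP a0 pv; split=> //.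
  rewrite extend_source // add0r {1}/y a0 eqxx.
  rewrite (eq_big_seq (extend x)) => [|e ep].
    by lra.
  by rewrite /y (negPf (dipath_src_neq0 (tgt_neq0 a) pv ep)).
exists y; split.
- by move=> e /negPf; rewrite /y => ->.
- move=> P; have [a [p /yE[a0 headP ->]]] := route_head P.
  by rewrite lerDl subr_ge0; apply: (mP a a0).2.
- move=> P; have [a [p /yE[a0 headP ->]]] := route_head P.
  have [[P' headP' P'E] minP'] := mP a a0.
  split=> [/fibre_argminP/(_ P')|/eqP].
    rewrite headP' headP => /(_ erefl); rewrite P'E => Pm.
    have -> : cost h (extend x) P = m a.
      by apply/eqP; rewrite eq_le Pm minP'.
    by rewrite subrr addr0.
  rewrite -subr_eq0 addrAC subrr add0r subr_eq0 => /eqP PE.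
  by apply/fibre_argminP => Q; rewrite headP PE; apply: minP'.
move=> e e0; have [[P headP PE] minP] := mP e e0.
exists P; last by move/eqP: headP; rewrite -source_edge_head => /andP[].
by apply/fibre_argminP => Q; rewrite headP PE; apply: minP.
Qed.

Lemma fibre_argmin_argmin x : exists y, fibre_argmin x = argmin (cost h y).
Proof.
have [y [_ y_ge y_eq meet]] := fibre_argmin_lift x; exists y.
have [e e0] := @has_out_edge n G ord0 isT.
have [P0 /y_eq P0E _] := meet e e0.
apply/setP => P; apply/idP/argminP => [/y_eq PE Q|minP].
  by rewrite /cost PE addNr addrC subr_ge0.
apply/y_eq/eqP; rewrite eq_le y_ge andbT -subr_le0 addrC.
by have := minP P0; rewrite {2}/cost P0E addNr.
Qed.

Definition clique_cell (S : {set route G}) : set (trop_index F -> R) :=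
  [set x | S \subset fibre_argmin x].

(** * Bounded cells *)

(** Raising the weight of the edge [e] alone, in normalised coordinates. *)
Definition raise_direction e : trop_index F -> R :=
  normalise (fun f => (f == e)%:R).

Lemma potential_later e v : (src e < v)%N ->
  potential (fun f => (f == e)%:R) v = 0.
Proof.
move=> ev; apply: big1_seq => f /andP[_ fv].
have := leq_trans ev (dipath_src_ge (bottom_path_dipath v) fv).
by have [->|] := eqVneq f e; rewrite ?ltnn.
Qed.

Lemma potential_src e : potential (fun f => (f == e)%:R) (src e) =
  (label F e == 0%N)%:R.
Proof.
have [g ge g0] := bottom_edge (src_neq_max e).
rewrite -ge /potential (bottom_path_cons g0) big_cons -/(potential _ _).
rewrite potential_later ?addr0 -?ge ?edge_lt //.
have [<-|ne] := eqVneq g e; first by rewrite g0.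
suff /negPf-> : label F e != 0%N by [].
by apply/negP => /eqP e0; case/eqP: ne; apply: bottom_edge_unique.
Qed.

(** If [e] has positive label, the coordinate of [e] itself is 1. Otherwise [e]
    is the bottom edge, all other edges leaving its tail get coordinate -1, and
    [f] provides one. *)
Lemma raise_direction_unit e f : src f = src e -> f != e -> src e != ord0 ->
  exists i, `|raise_direction e i| = 1.
Proof.
move=> fe ne es; have [e0|e0] := eqVneq (label F e) 0%N; last first.
  have [i ie] := inner_src_trop es e0; exists i.
  rewrite /raise_direction /normalise ie eqxx potential_later ?edge_lt //.
  by rewrite potential_src (negPf e0) addr0 subr0 normr1.
have f0 : label F f != 0%N.
  by apply: contra ne => /eqP f0; apply/eqP; apply: bottom_edge_unique.
have fs : src f != ord0 by rewrite fe.
have [i ifE] := inner_src_trop fs f0; exists i.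
rewrite /raise_direction /normalise ifE (negPf ne) potential_later; last first.
  by rewrite -fe edge_lt.
by rewrite fe potential_src e0 eqxx addr0 sub0r normrN1.
Qed.

(** Raising the weight of an edge missed by [S] leaves the costs of the routes
    of [S] unchanged and does not decrease any other cost; normalisation shifts
    the costs within a fibre by a common constant. *)
Lemma clique_cell_recedes (S : {set route G}) e x t :
  (forall P, P \in S -> e \notin redges P) -> 0 <= t ->
  clique_cell S x -> clique_cell S (fun i => x i + t * raise_direction e i).
Proof.
move=> eS t0 /fintype.subsetP Sx; apply/fintype.subsetP => P PS.
have extE f : extend (fun i => x i + t * raise_direction e i) f =
    extend x f + t * extend (raise_direction e) f.
  by rewrite /extend; case: insubP => //= _; rewrite mulr0 addr0.
have costE Q a p : redges Q = a :: p ->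
    cost h (extend (fun i => x i + t * raise_direction e i)) Q =
    cost h (extend x) Q + t * (\sum_(f <- redges Q) (f == e)%:R -
      ((a == e)%:R + potential (fun f => (f == e)%:R) (tgt a))).
  move=> Qap; rewrite /cost; under eq_bigr do rewrite extE.
  by rewrite big_split /= -mulr_sumr (sum_normalise _ Qap) addrA.
apply/fibre_argminP => Q; have [a [p Pap]] := route_head P.
have [b [q Qbq]] := route_head Q; move=> headQ.
move: (headQ); rewrite Pap Qbq /= => -[ba].
rewrite (costE _ _ _ Pap) (costE _ _ _ Qbq) ba lerD //.
  by have /fibre_argminP := Sx P PS; apply.
rewrite ler_wpM2l // lerD2r [X in X <= _]big1_seq.
  by apply: sumr_ge0 => f _; rewrite ler0n.
move=> f /andP[_ fP]; have [fe|//] := eqVneq f e.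
by have := eS P PS; rewrite -fe fP.
Qed.

(** By induction on its tail [v], every edge [e] is covered: the edges
    entering [v] are, so some route of [S] passes through [v]. If [e] were not
    covered, this route would leave [v] by another edge, and the cell would
    recede in the nonzero direction of [e]. *)
Lemma bounded_covers (S : {set route G}) x : clique_cell S x ->
  meets_source_edges S -> coord_bounded (clique_cell S) -> covers S.
Proof.
move=> Sx meet [M bdM].
suff cov v e : src e = v -> exists2 P, P \in S & e \in redges P.
  by move=> e; apply: cov erefl.
elim/vertex_ind_up: v e => v IHv e ev.
have [v0|v0] := eqVneq v ord0; first by apply: meet; rewrite ev.
apply: contrapT => ncov.
have eS P : P \in S -> e \notin redges P.
  by move=> PS; apply/negP => eP; apply: ncov; exists P.
have [g gv] := @has_in_edge n G v v0.
have [|P PS gP] := IHv (src g) _ g erefl; first by rewrite -gv edge_lt.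
have [p [[|f q] [Ppq _ gq]]] := route_split gP.
  by move: gq; rewrite /= gv -ev (negPf (src_neq_max e)).
have fv : src f = src e by move: gq => /= /andP[/eqP-> _]; rewrite gv ev.
have fP : f \in redges P by rewrite Ppq mem_cat !inE eqxx !orbT.
have fe : f != e by apply: contraNneq (eS P PS) => <-.
have [|i di] := raise_direction_unit fv fe; first by rewrite ev.
have M0 : 0 <= M by apply: le_trans (normr_ge0 _) (bdM x Sx i).
(* A step long enough to leave the box of radius [M] from any of its points. *)
have t0 : 0 <= M + M + 1 by lra.
have := bdM _ (clique_cell_recedes eS t0 Sx) i; have := bdM x Sx i => xM xtM.
have : `|(M + M + 1) * raise_direction e i| <= M + M.
  rewrite -[X in `|X|](addrK (x i)) (le_trans (ler_normB _ _)) //.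
  by rewrite lerD // addrC.
by rewrite normrM di mulr1 ger0_norm //; lra.
Qed.

(** Let [dist v a] mean that the beginning up to [v] of some route of [S] has
    weight [a]. Exchanging one such beginning for another turns a route of [S]
    into a route; all routes have weight at least [- H], and those of [S] have
    weight at most [H], so [a] is determined up to [2 * H]. Going backwards from
    the sink along bottom edges, of weight 0, bounds [a], and the weight of an
    edge is a difference of two such numbers. *)
Lemma covers_bounded (S : {set route G}) :
  covers S -> coord_bounded (clique_cell S).
Proof.
move=> cov; pose H : R := \sum_P `|h P|.
have hH P : `|h P| <= H.
  by rewrite /H (bigD1 P) //= lerDl sumr_ge0.
have H0 : 0 <= H by apply: sumr_ge0.
pose B (v : V) : R := H + H * (2 * (n.+1 - v))%:R.
exists (B ord0 + B ord0) => x /fintype.subsetP Sx i.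
have [y [yx y_ge y_eq _]] := fibre_argmin_lift x.
have tight P : P \in S -> \sum_(e <- redges P) y e = h P by move/Sx/y_eq.
pose dist v (a : R) := exists p q, [/\ dipath (G := G) ord0 p v,
  dipath v q ord_max, \sum_(e <- p) y e = a
  & \sum_(e <- p) y e + \sum_(e <- q) y e <= H].
have dist_le v a b : dist v a -> dist v b -> a - b <= H *+ 2.
  move=> [p [q [pv vq pa pqH]]] [p' [_ [p'v _ p'b _]]].
  have p'q : dipath ord0 (p' ++ q) ord_max by apply/dipath_cat; exists v.
  have := y_ge (mk_route p'q); rewrite redges_mk big_cat /= p'b => ge1.
  have := hH (mk_route p'q); rewrite ler_norml => /andP[ge2 _].
  by rewrite pa in pqH; rewrite mulr2n; lra.
have dist_edge e : exists2 a, dist (src e) a & dist (tgt e) (a + y e).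
  have [P PS eP] := cov e; have [p [q [Ppq pe qe]]] := route_split eP.
  have := hH P; rewrite ler_norml => /andP[_].
  rewrite -(tight P PS) Ppq big_cat big_cons /= => leH.
  exists (\sum_(e <- p) y e).
    by exists p, (e :: q); rewrite /= eqxx big_cons.
  exists (p ++ [:: e]), q; rewrite dipath_cat_cons pe /= eqxx big_cat big_seq1.
  by split=> //; rewrite -addrA.
have BM (u v : V) : (u <= v)%N -> B v <= B u.
  by move=> uv; rewrite /B lerD2l ler_wpM2l // ler_nat leq_mul2l leq_sub2l.
have B_step e : B (tgt e) + H *+ 2 <= B (src e).
  rewrite /B -addrA lerD2l -[H *+ 2]mulr_natr -mulrDr ler_wpM2l //.
  rewrite -natrD ler_nat.
  rewrite -[X in (_ + X)%N]muln1 -mulnDr leq_mul2l /= addn1.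
  rewrite ltn_sub2l ?edge_lt //.
  exact: leq_trans (edge_lt e) (leq_ord _).
have HB v : H <= B v by rewrite /B lerDl mulr_ge0 // ler0n.
have dist_bd v a : dist v a -> `|a| <= B v.
  elim/vertex_ind_down: v a => v IHv a va.
  have [vE|vE] := eqVneq v ord_max.
    apply: le_trans (HB v); have [p [q [pv vq pa pqH]]] := va.
    have q0 : q = [::].
      by case: q vq {pqH} => //= f q; rewrite vE (negPf (src_neq_max f)).
    rewrite vE in pv; have := y_ge (mk_route pv).
    have := hH (mk_route pv); rewrite redges_mk pa !ler_norml => /andP[? _] ?.
    by rewrite pa q0 big_nil in pqH; apply/andP; split; lra.
  have [v0|v0] := eqVneq v ord0.
    have [[|f p] [q [p0 _ pa _]]] := va.
      by rewrite -pa big_nil normr0 (le_trans H0).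
    by move: p0 => /= /andP[_ /dipath_le];
      rewrite v0 => /(leq_trans (edge_lt f)).
  have [e ev e0] := bottom_edge vE.
  have ye : y e = 0 by rewrite yx ?extend_bottom // ev.
  have [b] := dist_edge e; rewrite ye addr0 ev => vb tb.
  have ev_lt : (v < tgt e)%N by rewrite -ev edge_lt.
  have := IHv _ ev_lt b tb; have := B_step e; rewrite ev.
  have := dist_le _ _ _ va vb; have := dist_le _ _ _ vb va.
  by rewrite !ler_norml => ? ? ? /andP[? ?]; apply/andP; split; lra.
have [a d1 d2] := dist_edge (val i).
rewrite -extend_val -yx; last by have /andP[] := valP i; rewrite inner_src.
rewrite -[y _](addKr a) (le_trans (ler_normD _ _)) // normrN.
apply: lerD; first exact: le_trans (dist_bd _ _ d1) (BM ord0 _ (leq0n _)).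
exact: le_trans (dist_bd _ _ d2) (BM ord0 _ (leq0n _)).
Qed.

(** * Tropical cells as cliques *)

Lemma argmin_costE y :
  argmin (fun P => - h P + dot (indic R P) y) = argmin (cost h y).
Proof.
by apply/setP => P; rewrite !inE; apply: eq_forallb => Q; rewrite !dot_indic.
Qed.

Lemma meets_source_edges_neq0 (S : {set route G}) :
  meets_source_edges S -> S != finset.set0.
Proof.
have [e e0] := @has_out_edge n G ord0 isT.
by move=> /(_ e e0)[P PS _]; apply/set0Pn; exists P.
Qed.

Hypothesis adm : admissible F h.

Lemma argmin_clique y : clique F (argmin (cost h y)).
Proof.
have : regular_subdivision h (conv_hull (indic R) (argmin (cost h y))).
  by exists y; rewrite argmin_costE.
by rewrite adm => -[S [S_clique _ /conv_hull_indic_inj ->]].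
Qed.

Lemma clique_argmin (S : {set route G}) : clique F S -> S != finset.set0 ->
  exists y, S = argmin (cost h y).
Proof.
move=> S_clique S0.
have : framed_triangulation F (conv_hull (indic R) S) by exists S.
by rewrite -adm => -[y /conv_hull_indic_inj]; rewrite argmin_costE; exists y.
Qed.

Lemma fibre_argmin_clique x : clique F (fibre_argmin x).
Proof. by have [y ->] := fibre_argmin_argmin x; apply: argmin_clique. Qed.

Lemma clique_fibre_argmin (S : {set route G}) : clique F S ->
  meets_source_edges S -> exists x, fibre_argmin x = S.
Proof.
move=> S_clique meet.
have [y SE] := clique_argmin S_clique (meets_source_edges_neq0 meet).
by exists (normalise y); rewrite fibre_argmin_normalise -?SE.
Qed.

Lemma clique_cell_subset (S T : {set route G}) :
  clique F S -> meets_source_edges S ->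
  clique_cell S `<=` clique_cell T <-> T \subset S.
Proof.
move=> S_clique meet; split=> [sub|TS x]; last exact: fintype.subset_trans TS.
have [x xS] := clique_fibre_argmin S_clique meet.
by have /= := sub x; rewrite /clique_cell /= xS; apply.
Qed.

Lemma redges_prepend (a : source_edge G) (Q : subroute a) :
  redges (prepend Q) = val a :: val Q.
Proof. by []. Qed.

(** Coordinates of [extend x] at source edges and edges of label 0 vanish, so
    that only the coordinates in [trop_index F] contribute to the cost. *)
Lemma trop_termE (a : source_edge G) x (Q : subroute a) :
  trop_term h x Q = cost h (extend x) (prepend Q).
Proof.
rewrite /trop_term /cost redges_prepend big_cons.
rewrite extend_source ?add0r; last first.
  by have := valP a; rewrite inE => /eqP.
have := redges_uniq (prepend Q); rewrite redges_prepend => /andP[_ uQ].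
congr (_ + _); rewrite (big_uniq _ uQ) /dot.
transitivity (\sum_(i : trop_index F | val i \in (val Q : seq E))
    extend x (val i)).
  rewrite [RHS]big_mkcond; apply: eq_bigr => i _; rewrite extend_val /trop_vec.
  by case: ifP => _; rewrite ?mul1r ?mul0r.
rewrite -big_sub_cond [RHS]big_mkcond [LHS]big_mkcond; apply: eq_bigr => e _.
rewrite unfold_in /=.
have [//|eI] := boolP (inner (src e) && (0 < label F e)%N).
by rewrite /= /extend insubN // if_same.
Qed.

(** The edge [a] cannot occur in the rest of [P], since no edge of [P] after
    the first one leaves the source. *)
Lemma prepend_surj (a : source_edge G) P : ohead (redges P) = Some (val a) ->
  exists Q : subroute a, prepend Q = P.
Proof.
have [b [p Pbp]] := route_head P; rewrite Pbp => -[ba]; subst b.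
have := redges_dipath P; rewrite Pbp => /= /andP[a0 pv].
have sz : (size p <= n.+1)%N.
  apply: ltnW; have := route_size (redges_dipath P).
  by rewrite Pbp.
have pQ : dipath (tgt (val a)) (Bseq sz) ord_max &&
    all (mem (sub_edges a)) (Bseq sz).
  rewrite /= pv; apply/allP => e ep; rewrite !inE; apply/andP; split.
    apply: contra (dipath_src_neq0 (tgt_neq0 _) pv ep) => /eqP->.
    by have := valP a; rewrite inE.
  by apply/existsP; exists P; rewrite Pbp eqxx /= inE ep orbT.
by exists (Sub (Bseq sz) pQ); apply: redges_inj; rewrite redges_prepend Pbp.
Qed.

Lemma argmin_trop_term (a : source_edge G) x (Q : subroute a) :
  (Q \in argmin (trop_term h x (a := a))) = (prepend Q \in fibre_argmin x).
Proof.
rewrite inE; apply/forallP/fibre_argminP => [minQ P|minQ Q'].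
  by case/prepend_surj => Q' <-; rewrite -!trop_termE.
by rewrite !trop_termE; apply: minQ.
Qed.

(** The sets [A a] that define the cells of the single decompositions unite to
    one set [S] of routes. It is a clique because the cell is nonempty: it lies
    in the clique [fibre_argmin x0] of any point [x0] of the cell. *)
Lemma trop_cellP (C : set (trop_index F -> R)) : trop_cell h C <->
  exists S, [/\ clique F S, meets_source_edges S & C = clique_cell S].
Proof.
split=> [[[x0 Cx0] [D DC CE]]|[S [S_clique meet ->]]].
  pose A a := sval (cid (DC a)).
  have AP a : [/\ A a != finset.set0, D a !=set0 &
      D a = [set x | A a \subset argmin (trop_term h x (a := a))]].
    by rewrite /A; case: cid.
  pose S : {set route G} :=
    [set P | [exists a, [exists Q in A a, P == prepend Q]]]%SET.
  have CS : C = clique_cell S.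
    rewrite CE; apply/seteqP; split=> x /= Hx.
      apply/fintype.subsetP => P; rewrite inE.
      move=> /existsP[a /exists_inP[Q QA /eqP->]].
      rewrite -argmin_trop_term; have := Hx a I; have [_ _ ->] := AP a.
      by move=> /fintype.subsetP; apply.
    move=> a _; have [_ _ ->] := AP a; apply/fintype.subsetP => Q QA.
    rewrite argmin_trop_term; apply: (fintype.subsetP Hx).
    by rewrite inE; apply/existsP; exists a; apply/exists_inP; exists Q.
  exists S; split=> //.
    move: Cx0; rewrite CS => /fintype.subsetP Sx.
    apply/forall_inP => P /Sx Px; apply/forall_inP => Q /Sx Qx.
    by have /forall_inP/(_ P Px)/forall_inP/(_ Q Qx) := fibre_argmin_clique x0.
  move=> e e0; have eO : e \in Out G ord0 by rewrite inE e0.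
  pose a : source_edge G := Sub e eO.
  have [/set0Pn[Q QA] _ _] := AP a; exists (prepend Q).
    by rewrite inE; apply/existsP; exists a; apply/exists_inP; exists Q.
  by rewrite redges_prepend mem_head.
split.
  have [x xS] := clique_fibre_argmin S_clique meet; exists x.
  by rewrite /clique_cell /= xS.
pose A (a : source_edge G) : {set subroute a} := [set Q | prepend Q \in S]%SET.
exists (fun a => [set x | A a \subset argmin (trop_term h x (a := a))]) => [a|].
  exists (A a); split=> //.
    have a0 : src (val a) = ord0 by have := valP a; rewrite inE => /eqP.
    have [P PS aP] := meet _ a0.
    have /eqP/prepend_surj[Q QP] : ohead (redges P) == Some (val a).
      by rewrite -source_edge_head a0 eqxx.
    by apply/set0Pn; exists Q; rewrite inE QP.
  have [x xS] := clique_fibre_argmin S_clique meet; exists x => /=.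
  by apply/fintype.subsetP => Q; rewrite inE argmin_trop_term xS.
apply/seteqP; split=> x /= Hx.
  move=> a _; apply/fintype.subsetP => Q; rewrite inE argmin_trop_term.
  exact: fintype.subsetP.
apply/fintype.subsetP => P PS; have [e [p Pe]] := route_head P.
have /andP[e0 _] : (src e == ord0) && (e \in redges P).
  by rewrite source_edge_head Pe.
have eO : e \in Out G ord0 by rewrite inE.
have [Q QP] := @prepend_surj (Sub e eO) P (congr1 ohead Pe).
have /fintype.subsetP/(_ Q) := Hx (Sub e eO) I.
by rewrite inE QP argmin_trop_term QP; apply.
Qed.

Lemma bounded_trop_cellP (C : set (trop_index F -> R)) :
  bounded_trop_cell h C <->
  exists S, [/\ clique F S, covers S & C = clique_cell S].
Proof.
split=> [[/trop_cellP[S [S_clique meet ->]] bd]|[S [S_clique cov ->]]].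
  exists S; split=> //; have [x xS] := clique_fibre_argmin S_clique meet.
  have Sx : clique_cell S x by rewrite /clique_cell /= xS.
  exact: bounded_covers Sx meet bd.
split; last exact: covers_bounded.
by apply/trop_cellP; exists S; split=> // e _; apply: cov.
Qed.

End Framed.

(** * The isomorphism *)

(** The two families are parametrised by the same index type. Since inclusion
    is antisymmetric, comparing the orders in both directions shows that
    [gA S] and [gB S] determine each other. *)
Lemma poset_iso_of_embeddings (A B K : Type) (D : K -> Prop)
    (PA : set (set A)) (PB : set (set B)) (gA : K -> set A) (gB : K -> set B) :
  (forall X, PA X <-> exists2 S, D S & X = gA S) ->
  (forall Y, PB Y <-> exists2 S, D S & Y = gB S) ->
  (forall S T, D S -> D T -> gA S `<=` gA T <-> gB T `<=` gB S) ->
  poset_isomorphic (fun X Y : {X | PA X} => sval X `<=` sval Y)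
    (fun X Y : {Y | PB Y} => sval Y `<=` sval X).
Proof.
move=> PAE PBE gAB.
have Y_of (X : {X | PA X}) : exists Y : {Y | PB Y},
    exists2 S, D S & sval X = gA S /\ sval Y = gB S.
  case: X => X PX; have [S DS XS] := (PAE X).1 PX.
  have PY : PB (gB S) by apply/PBE; exists S.
  by exists (exist _ (gB S) PY), S.
have [f fP] := choice Y_of.
have f_mono X Y : sval X `<=` sval Y <-> sval (f Y) `<=` sval (f X).
  have [S DS [-> ->]] := fP X; have [T DT [-> ->]] := fP Y.
  exact: gAB.
have sval_inj (Z : Type) (Q : set (set Z)) (X Y : {X | Q X}) :
    sval X = sval Y -> X = Y.
  by case: X Y => [X PX] [Y PY] /= XY; apply: eq_exist.
have X_of (Y : {Y | PB Y}) : exists X, f X = Y.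
  case: Y => Y PY; have [S DS YS] := (PBE Y).1 PY.
  have PX : PA (gA S) by apply/PAE; exists S.
  exists (exist _ _ PX); apply: sval_inj => /=.
  have [T DT [/= ST ->]] := fP (exist _ _ PX).
  by rewrite YS; apply/seteqP; split; apply/gAB; rewrite ?ST.
have [g fg] := choice X_of.
exists f => //; exists g => // X; apply: sval_inj; apply/seteqP.
by split; apply/f_mono; rewrite fg.
Qed.

Theorem theorem3p2 (R : realType) (n : nat) (G : flow_graph n) (F : framing G)
    (h : route G -> R) (adm_h : admissible F h) :
  poset_isomorphic (@le_tropical n G F R h) (@le_combinatorial n G F R).
Proof.
apply: (@poset_iso_of_embeddings _ _ _
  (fun S : {set route G} => clique F S /\ covers S) _ _
  (clique_cell (F := F) h) (conv_hull (indic R))).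
- move=> C; split=> [|[S [SF Scov] ->]].
    by move=> /(bounded_trop_cellP adm_h)[S [SF Scov ->]]; exists S.
  by apply/(bounded_trop_cellP adm_h); exists S.
- move=> K; split=> [/interior_faceP[S [SF Scov ->]]|[S [SF Scov] ->]].
    by exists S.
  by apply/interior_faceP; exists S.
move=> S T [SF Scov] _; rewrite conv_hull_indicP.
by apply: (clique_cell_subset adm_h) => // e _; apply: Scov.
Qed.
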